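(* Let $\mathcal{A}$ be an alphabet, $\mathcal{V}$ a family of blurred sets of $\mathcal{A}$, $\Lambda\subset\mathcal{A}^{\mathbb{N}}$ a shift space and $\Sigma_\Lambda=\Sigma_\Lambda^{\mathcal{V}}$ its blur shift space. Then $\Sigma_\Lambda$ is compact if and only if $\mathcal{V}_\Lambda$ is a finite family of sets which covers all except a finite number of elements of $B_1(\Lambda)$, i.e. $\mathcal{V}_\Lambda$ is finite and $B_1(\Lambda)\setminus\bigcup_{H\in\mathcal{V}_\Lambda}H$ is finite.
   Context: $\mathbb{N}=\{0,1,2,\dots\}$. An alphabet is a nonempty set $\mathcal{A}$. On $\mathcal{A}^{\mathbb{N}}$ the shift map is $\sigma((x_i)_i)=(x_{i+1})_i$. A shift space is a set $\Lambda\subset\mathcal{A}^{\mathbb{N}}$ consisting of all sequences in which no word of some given set of nonempty finite words occurs; equivalently, $\Lambda$ is closed in the product of discrete topologies and $\sigma(\Lambda)\subset\Lambda$. $B_n(\Lambda)$ is the set of words $x_0\dots x_{n-1}$ with $x\in\Lambda$, $B_0(\Lambda)=\{\epsilon\}$ (empty word), $B(\Lambda)=\bigcup_{n\ge0}B_n(\Lambda)$; in particular $B_1(\Lambda)$ is the set of letters occurring in $\Lambda$. For a word $w$, $\mathcal{F}_\Lambda(w)=\{a\in\mathcal{A}:\ wa\in B(\Lambda)\}$. A family of blurred sets (a resolution) is any (possibly empty) family $\mathcal{V}$ of infinite subsets of $\mathcal{A}$ such that $|G\cap H|<\infty$ for all distinct $G,H\in\mathcal{V}$. To each $H\in\mathcal{V}$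 one attaches a new symbol $\tilde H\notin\mathcal{A}$ (distinct symbols for distinct sets); $\tilde{\mathcal{V}}=\{\tilde H: H\in\mathcal{V}\}$, $\bar{\mathcal{A}}=\mathcal{A}\cup\tilde{\mathcal{V}}$, $\bar H=H\cup\{\tilde H\}$. The full blur shift is $\Sigma_{\mathcal{A}^{\mathbb{N}}}^{\mathcal{V}}=\mathcal{A}^{\mathbb{N}}\cup\{(x_0\dots x_{n-1}\tilde H\tilde H\tilde H\dots):\ n\ge0,\ x_i\in\mathcal{A},\ H\in\mathcal{V}\}$. The blur shift space of $\Lambda$ is $\Sigma_\Lambda^{\mathcal{V}}=\Lambda\cup\{(a_0\dots a_{n-1}\tilde H\tilde H\dots):\ n\ge0,\ H\in\mathcal{V},\ a_0\dots a_{n-1}\in B(\Lambda),\ |\mathcal{F}_\Lambda(a_0\dots a_{n-1})\cap H|=\infty\}$. Also $\mathcal{V}_\Lambda=\{H\in\mathcal{V}:\ |B_1(\Lambda)\cap H|=\infty\}$. Topology: $\Sigma_{\mathcal{A}^{\mathbb{N}}}^{\mathcal{V}}$ carries the topology with basis the generalized cylinders $Z(w_0\dots w_{n-1})=\{x: x_i=w_i,\ 0\le i\le n-1\}$ and $Z(w_0\dots w_{n-1}\bar H,F)=\{x: x_i=w_i,\ 0\le i\le n-1,\ x_n\in\bar H\setminus F\}$, where $n\ge0$, $w_i\in\mathcal{A}$, $H\in\mathcal{V}$, $F\subset H$ finite; $\Sigma_\Lambda^{\mathcal{V}}$ carries the induced topology. *)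

(* Defs.v *)
From HB Require Import structures.
From mathcomp Require Import all_boot all_order.
From mathcomp Require Import all_classical topology.

Set Implicit Arguments.
Unset Strict Implicit.
Unset Printing Implicit Defensive.

Local Open Scope classical_set_scope.

Section ShiftSpaces.
Context {A : Type}.
Implicit Types (x : nat -> A) (w : seq A) (L : set (nat -> A)).

Definition occurs w x := exists k, mkseq (fun i => x (k + i)) (size w) = w.

Definition shift_space L := exists F : set (seq A),
  ~ F [::] /\ L = [set x | forall w, F w -> ~ occurs w x].

(* [B_0] is [{epsilon}] by convention, also for the empty shift space. *)
Definition words_of_size L (n : nat) : set (seq A) :=
  if n is 0 then [set [::]] else [set mkseq x n | x in L].

Definition language L : set (seq A) := \bigcup_n words_of_size L n.

(* [B_1(L)], words of length one being identified with letters *)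
Definition letters L : set A := [set a | words_of_size L 1 [:: a]].

Definition followers L w : set A := [set a | language L (rcons w a)].

End ShiftSpaces.

Definition resolution {A : Type} (V : set (set A)) :=
  (forall H, V H -> infinite_set H) /\
  (forall G H, V G -> V H -> G <> H -> finite_set (G `&` H)).

Section BlurShift.
Context {A : Type}.
Variable V : set (set A).

(* [inr H] is the new symbol attached to the blurred set [H]. *)
Definition ext_alphabet : Type := (A + V)%type.

Definition ext_set (H : V) : set ext_alphabet :=
  inl @` (val H : set A) `|` [set inr H].

Definition letter_seq (y : nat -> A) : nat -> ext_alphabet := fun i => inl (y i).

(* the sequence [w_0 ... w_(n-1)] followed by [inr H] forever *)
Definition blur_seq (w : seq A) (H : V) : nat -> ext_alphabet :=
  nth (inr H) (map inl w).

Definition full_blur_set : set (nat -> ext_alphabet) :=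
  range letter_seq `|` [set blur_seq w H | w in setT & H in setT].

Definition full_blur : Type := full_blur_set.

Definition full_blur_seq (x : full_blur) : nat -> ext_alphabet := val x.
Coercion full_blur_seq : full_blur >-> Funclass.

HB.instance Definition _ := gen_eqMixin full_blur.
HB.instance Definition _ := gen_choiceMixin full_blur.

Definition cylinder (w : seq A) : set full_blur :=
  [set x | mkseq x (size w) = map inl w].

Definition blur_cylinder (w : seq A) (H : V) (F : set A) : set full_blur :=
  [set x | cylinder w x /\ (ext_set H `\` inl @` F) (x (size w))].

Definition generalized_cylinders : set (set full_blur) :=
  range cylinder `|`
  [set Z | exists w (H : V) (F : set A),
     [/\ finite_set F, F `<=` val H & Z = blur_cylinder w H F]].

Lemma cylinder_agree (w : seq A) (x y : full_blur) i :
  cylinder w x -> cylinder w y -> i < size w -> x i = y i.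
Proof.
rewrite /cylinder /= => wx wy iw.
by rewrite -(nth_mkseq (x i) x iw) wx -wy nth_mkseq.
Qed.

Lemma cylinder_le (v w : seq A) (t : full_blur) :
  size v <= size w -> cylinder v t -> cylinder w t ->
  cylinder w `<=` cylinder v.
Proof.
move=> vw vt wt x wx; rewrite /cylinder /= -vt.
by apply/eq_in_map => i; rewrite mem_iota => /andP[_ iv];
  apply: (cylinder_agree wx wt); exact: leq_trans vw.
Qed.

Lemma cylinder_lt (v w : seq A) (H : V) (F : set A) (t : full_blur) :
  size v < size w -> blur_cylinder v H F t -> cylinder w t ->
  cylinder w `<=` blur_cylinder v H F.
Proof.
move=> vw [vt Ht] wt x wx; split; first exact: (cylinder_le (ltnW vw) vt wt).
by rewrite (cylinder_agree wx wt vw).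
Qed.

Lemma cylinder_rcons (w : seq A) (a : A) (t : full_blur) :
  cylinder w t -> t (size w) = inl a -> cylinder (rcons w a) t.
Proof.
by rewrite /cylinder /= => wt ta; rewrite size_rcons mkseqS map_rcons wt ta.
Qed.

Lemma generalized_cylinders_cover :
  \bigcup_(Z in generalized_cylinders) Z = setT.
Proof.
apply/seteqP; split=> // x _; exists (cylinder [::]) => //.
by left; exists [::].
Qed.

Lemma generalized_cylinders_join (Y Z : set full_blur) (t : full_blur) :
  generalized_cylinders Y -> generalized_cylinders Z -> Y t -> Z t ->
  exists U, [/\ generalized_cylinders U, U t & U `<=` Y `&` Z].
Proof.
have cyl w : generalized_cylinders (cylinder w) by left; exists w.
have mix v w H F : finite_set F -> F `<=` val H ->
    cylinder v t -> blur_cylinder w H F t ->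
    exists U, [/\ generalized_cylinders U, U t &
                  U `<=` cylinder v `&` blur_cylinder w H F].
  move=> finF FH vt wt; have [vw|wv] := leqP (size v) (size w).
    exists (blur_cylinder w H F); split=> //.
      by right; exists w, H, F.
    by move=> x xw; split=> //; apply: (cylinder_le vw vt wt.1); case: xw.
  exists (cylinder v); split=> // x xv; split=> //.
  exact: (cylinder_lt wv wt vt).
have lt_case v H F w G E : size v < size w -> finite_set E -> E `<=` val G ->
    blur_cylinder v H F t -> blur_cylinder w G E t ->
    exists U, [/\ generalized_cylinders U, U t &
                  U `<=` blur_cylinder v H F `&` blur_cylinder w G E].
  move=> vw finE EG vt wt; exists (blur_cylinder w G E); split=> //.
    by right; exists w, G, E.
  by move=> x xw; split=> //; apply: (cylinder_lt vw vt wt.1); case: xw.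
move=> [[v _ <-]|[v [H [F [finF FH ->]]]]] [[w _ <-]|[w [G [E [finE EG ->]]]]].
- move=> vt wt; have [vw|/ltnW wv] := leqP (size v) (size w).
    exists (cylinder w); split=> // x xw; split=> //.
    exact: (cylinder_le vw vt wt).
  exists (cylinder v); split=> // x xv; split=> //.
  exact: (cylinder_le wv wt vt).
- exact: mix.
- by move=> vt wt; have := mix _ _ _ _ finF FH wt vt; rewrite setIC.
- move=> vt wt; have [vw|wv|vw] := ltngtP (size v) (size w).
  + exact: lt_case.
  + by have := lt_case _ _ _ _ _ _ wv finF FH wt vt; rewrite setIC.
  case tv : (t (size v)) => [a|K].
    have at' := cylinder_rcons vt.1 tv.
    exists (cylinder (rcons v a)); split=> // x xa.
    by split; [apply: (cylinder_lt _ vt at')|apply: (cylinder_lt _ wt at')];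
      rewrite // size_rcons ?vw.
  have KH : K = H by case: vt => _ []; rewrite tv => -[[]//|[]].
  have KG : K = G by case: wt => _ []; rewrite -vw tv => -[[]//|[]].
  subst H G.
  exists (blur_cylinder v K (F `|` E)); split.
  + right; exists v, K, (F `|` E); split=> //; first by rewrite finite_setU.
    by move=> a [/FH|/EG].
  + split; first exact: vt.1.
    split; last by rewrite tv => -[].
    by case: vt => _ [].
  + move=> x [xv [xK xFE]]; split; split=> //.
    * by split=> // -[a Fa ax]; apply: xFE; exists a => //; left.
    * by apply: (cylinder_le _ wt.1 vt.1) => //; rewrite vw.
    * by rewrite -vw; split=> // -[a Ea ax]; apply: xFE; exists a => //; right.
Qed.

HB.instance Definition _ := isBaseTopological.Build full_blur
  generalized_cylinders_cover generalized_cylinders_join.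

Definition blur_shift (L : set (nat -> A)) : set full_blur :=
  [set x | (exists2 y, L y & x = letter_seq y :> (nat -> ext_alphabet)) \/
           (exists w (H : V),
              [/\ language L w,
                  infinite_set (followers L w `&` val H) &
                  x = blur_seq w H :> (nat -> ext_alphabet)])].

(* the family [V_L] *)
Definition active_blurred_sets (L : set (nat -> A)) : set (set A) :=
  [set H | V H /\ infinite_set (letters L `&` H)].

End BlurShift.

Arguments generalized_cylinders {A} V.
Arguments blur_shift {A} V L.
Arguments active_blurred_sets {A} V L.

(* Main.v *)
Require Import Defs.
From mathcomp Require Import all_boot all_order.
From mathcomp Require Import all_classical topology.

Set Implicit Arguments.
Unset Strict Implicit.
Unset Printing Implicit Defensive.

Local Open Scope classical_set_scope.

(** Both directions rest on the first symbol that is not forced.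

    If the blur shift is compact, every point has a neighbourhood that is
    known from its first symbol: the cylinder of a letter, or the set of points
    whose first symbol lies in [ext_set H].  Discard the points that start with
    a letter covered by an active blurred set.  On each of these neighbourhoods
    the remaining points all have the same first symbol, so compactness leaves
    only finitely many first symbols ([finite_image_compact]).  These symbols
    include every uncovered letter, which starts a point of the shift space, and
    the new symbol of every active blurred set, whose constant sequence belongs
    to the blur shift.

    Conversely, let [U] be an ultrafilter on the blur shift and look at the
    words [w] whose cylinder belongs to [U]; the empty word is one.
    - If every such word extends by a letter to another one, iterating the
      extension produces an infinite sequence all of whose prefixes are in the
      language.  It lies in the shift space, which is closed, and [U] converges
      to it ([ultra_cvg_extendable]).
    - Otherwise some [w] is stuck.  By hypothesis, the points of the blur shift
      in its cylinder are covered by finitely many sets: the cylinders of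
      [rcons w a] for the finitely many uncovered letters [a], and the blurred
      cylinders of [w] for the finitely many active [H].  An ultrafilter
      selects one of them, and stuckness forces a blurred one.  As [U] avoids
      any finite union of cylinders of words [rcons w a], infinitely many
      letters of [H] follow [w], so [blur_seq w H] is a point of the blur
      shift, and [U] converges to it ([ultra_cvg_stuck]). *)

(** * Compactness and ultrafilters *)

(** If the image were infinite, the sets outside which [S] has a finite image
    would form a proper filter containing [K]; the neighbourhood given at a
    cluster point of it would be disjoint from a member of the filter. *)
Lemma finite_image_compact (T : topologicalType) (I : Type) (f : T -> I)
    (K S : set T) :
  compact K -> S `<=` K ->
  (forall x, K x -> exists2 N, nbhs x N & finite_set (f @` (S `&` N))) ->
  finite_set (f @` S).
Proof.
move=> cK SK locfin; apply: contrapT => infS.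
pose F : set_system T := [set B | finite_set (f @` (S `\` B))].
have FF : Filter F.
  split.
  - by rewrite /F /= setDT image_set0.
  - by move=> P Q; rewrite /F /= setDIr image_setU finite_setU.
  - move=> P Q PQ; apply: sub_finite_set; apply: image_subset.
    by move=> x [Sx nQ]; split=> // /PQ.
have PF : ProperFilter F by apply: Build_ProperFilter; rewrite /F /= setD0.
have FK : F K.
  rewrite /F /= (_ : S `\` K = set0) ?image_set0 //.
  by rewrite -subset0 => x [/SK].
have [x [Kx clx]] := cK F PF FK.
have [N xN finN] := locfin _ Kx.
have FN : F (~` N) by rewrite /F /= setDE setCK.
by have [y []] := clx _ _ FN xN.
Qed.

Lemma ultra_bigcup (T : Type) (I : choiceType) (U : set_system T) (D : set I)
    (f : I -> set T) :
  UltraFilter U -> finite_set D -> U (\bigcup_(i in D) f i) ->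
  exists2 i, D i & U (f i).
Proof.
move=> UU finD Uf; apply: contrapT => none.
have UI : U (\bigcap_(i in D) ~` f i).
  move/finite_fsetP: finD none {Uf} => [X ->] none.
  apply: filter_bigI => i iX; have [Ui|//] := in_ultra_setVsetC (f i) UU.
  by case: none; exists i.
have [x [[i Di fi]]] := filter_ex (filterI Uf UI).
by move=> /(_ i Di).
Qed.

Lemma ultra_setU (T : Type) (U : set_system T) (P Q : set T) :
  UltraFilter U -> U (P `|` Q) -> U P \/ U Q.
Proof.
move=> UU UPQ; have [|UnP] := in_ultra_setVsetC P UU; first by left.
by right; apply: filterS (filterI UPQ UnP) => x [[]].
Qed.

Lemma set_type_surj (T : Type) (X : set T) t : X t -> exists u : X, val u = t.
Proof. by move=> Xt; exists (SigSub (mem_set Xt)). Qed.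

(** * The language of a shift space *)

Section Language.
Context {A : Type}.
Implicit Types (x y : nat -> A) (w : seq A) (L : set (nat -> A)) (a : A).

Lemma take_mkseq n x m : n <= m -> take n (mkseq x m) = mkseq x n.
Proof. by move=> nm; rewrite /mkseq -map_take take_iota (minn_idPl nm). Qed.

Lemma languageP L w :
  language L w <-> w = [::] \/ (exists2 y, L y & mkseq y (size w) = w).
Proof.
split=> [[[_ ->|n _ [y Ly <-]]]|[->|[y Ly wy]]].
- by left.
- by right; exists y => //; rewrite size_mkseq.
- by exists 0.
- case: w wy => [|a w] wy; first by exists 0.
  by exists (size (a :: w)) => //; exists y.
Qed.

Lemma language_take L w n : language L w -> language L (take n w).
Proof.
move=> Lw; have [nw|/ltnW wn] := leqP n (size w); last first.
  by rewrite take_oversize.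
move/languageP: Lw => [->|[y Ly wy]]; first by apply/languageP; left.
by apply/languageP; right; exists y => //; rewrite -wy take_mkseq // size_mkseq.
Qed.

Lemma lettersP L a : letters L a <-> exists2 y, L y & y 0 = a.
Proof.
by split=> [[y Ly [ya]]|[y Ly ya]]; exists y => //; rewrite /mkseq /= ya.
Qed.

Lemma followers_nil L : followers L [::] = letters L.
Proof.
apply/seteqP; split=> a; rewrite /followers /=.
  by move/languageP=> [//|[y Ly [ya]]]; apply/lettersP; exists y.
by move=> La; exists 1.
Qed.

Lemma shift_space_shift L x n :
  shift_space L -> L x -> L (fun i => x (n + i)).
Proof.
move=> [F [_ ->]] Lx w Fw [k wk]; apply: (Lx w Fw); exists (n + k).
by rewrite -[RHS]wk; apply: eq_mkseq => i; rewrite addnA.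
Qed.

Lemma followers_letters L w : shift_space L -> followers L w `<=` letters L.
Proof.
move=> HL a /languageP[|[y Ly]]; first by case: w.
rewrite size_rcons mkseqS => /rcons_inj[_ ya]; apply/lettersP.
by exists (fun i => y (size w + i));
  [exact: (shift_space_shift _ HL Ly)|rewrite addn0].
Qed.

(** A forbidden word is nonempty, so a prefix that contains it is a prefix of
    some genuine point of the shift space, which is absurd. *)
Lemma shift_space_closed L x :
  shift_space L -> (forall n, language L (mkseq x n)) -> L x.
Proof.
move=> [F [F0 EL]] Lx; rewrite EL => w Fw [k wk].
have w0 : 0 < size w by case: w Fw {wk}.
have /languageP[|[y]] := Lx (k + size w).
  by move/(congr1 size)/eqP; rewrite size_mkseq addn_eq0 (gtn_eqF w0) andbF.
rewrite size_mkseq EL => Ly yx; apply: (Ly w Fw); exists k.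
rewrite -[RHS]wk; apply/eq_in_map => i; rewrite mem_iota => /andP[_ iw].
have ki : k + i < k + size w by rewrite ltn_add2l.
by rewrite -(nth_mkseq (x (k + i)) y ki) yx nth_mkseq.
Qed.

End Language.

(** * Points and neighbourhoods of the full blur shift *)

Section FullBlur.
Context {A : choiceType} {V : set (set A)}.
Implicit Types (w v : seq A) (H G : V) (x : full_blur V) (a : A)
  (y : nat -> A).

Lemma full_blur_letter_seq y :
  exists x : full_blur V, x = letter_seq V y :> (nat -> ext_alphabet V).
Proof.
apply: (set_type_surj (X := @full_blur_set _ V)).
by left; exists y.
Qed.

Lemma full_blur_blur_seq w H :
  exists x : full_blur V, x = blur_seq w H :> (nat -> ext_alphabet V).
Proof.
apply: (set_type_surj (X := @full_blur_set _ V)).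
by right; exists w => //; exists H.
Qed.

Lemma ext_set_letter H a : ext_set H (inl a) <-> val H a.
Proof. by split=> [[[b Hb [<-]]|]|Ha] //; left; exists a. Qed.

Lemma ext_set_symbol H G : ext_set H (inr G) <-> G = H.
Proof. by split=> [[[]|[]]//|->]; right. Qed.

Lemma cylinder_nil x : cylinder [::] x.
Proof. by []. Qed.

Lemma cylinder_inj v w x :
  cylinder v x -> cylinder w x -> size v = size w -> v = w.
Proof.
rewrite /cylinder /= => vx wx vw.
by apply: (inj_map (f := @inl A V)) => [a b [] //|]; rewrite -vx -wx vw.
Qed.

Lemma cylinder_letter_seq y x n :
  x = letter_seq V y :> (nat -> ext_alphabet V) -> cylinder (mkseq y n) x.
Proof.
by move=> xy; rewrite /cylinder /= xy size_mkseq /mkseq -map_comp.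
Qed.

Lemma cylinder_blur_seq w H x :
  x = blur_seq w H :> (nat -> ext_alphabet V) -> cylinder w x.
Proof.
move=> xw; rewrite /cylinder /= xw.
by rewrite -[RHS](mkseq_nth (inr H)) size_map.
Qed.

Lemma blur_seq_size w H : blur_seq w H (size w) = inr H.
Proof. by rewrite /blur_seq nth_default // size_map. Qed.

Lemma blur_seq_symbol w H G n : blur_seq w H n = inr G -> size w <= n /\ G = H.
Proof.
rewrite /blur_seq; have [wn|nw] := leqP (size w) n.
  by rewrite nth_default ?size_map // => -[].
by case: w nw => // b w nw; rewrite (nth_map b).
Qed.

Lemma cylinder_letter v x i : cylinder v x -> i < size v ->
  exists a, x i = inl a.
Proof.
rewrite /cylinder /= => vx iv; case: v iv vx => // b v iv vx.
exists (nth b (b :: v) i).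
by rewrite -(nth_mkseq (x i) x iv) vx (nth_map b).
Qed.

(** A word of letters can only be read before the new symbol starts. *)
Lemma cylinder_blur_seq_prefix v w H x :
  x = blur_seq w H :> (nat -> ext_alphabet V) -> cylinder v x ->
  size v <= size w /\ v = take (size v) w.
Proof.
move=> xw vx; have vw : size v <= size w.
  rewrite leqNgt; apply/negP => /(cylinder_letter vx)[a].
  by rewrite xw blur_seq_size.
split=> //; apply: (inj_map (f := @inl A V)) => [a b [] //|].
rewrite map_take; have /= <- := cylinder_blur_seq xw.
by rewrite take_mkseq.
Qed.

Lemma blur_cylinder0 w H x :
  blur_cylinder w H set0 x <-> cylinder w x /\ ext_set H (x (size w)).
Proof. by rewrite /blur_cylinder image_set0 setD0. Qed.

Lemma nbhs_generalized_cylinder x Z :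
  generalized_cylinders V Z -> Z x -> nbhs x Z.
Proof.
move=> gZ Zx; rewrite nbhsE; exists Z => //; split=> //.
by exists [set Z]; [move=> _ ->|rewrite bigcup_set1].
Qed.

Lemma nbhs_generalized_cylinderP x B : nbhs x B ->
  exists2 Z, generalized_cylinders V Z & Z x /\ Z `<=` B.
Proof.
rewrite nbhsE => -[O [[D DV <-] [Z DZ Zx]] OB].
exists Z; first exact: DV.
by split=> // t Zt; apply: OB; exists Z.
Qed.

(** A generalized cylinder around a sequence of letters is decided by a
    prefix of it; a blurred cylinder of [v] needs one letter beyond [v]. *)
Lemma cvg_letter_seq (U : set_system (full_blur V)) y x : Filter U ->
  x = letter_seq V y :> (nat -> ext_alphabet V) ->
  (forall n, U (cylinder (mkseq y n))) -> U --> x.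
Proof.
move=> FU xy Uy B /nbhs_generalized_cylinderP[Z gZ [Zx ZB]].
apply: filterS ZB _; case: gZ Zx => [[v _ <-]|[v [H [F [_ _ ->]]]]] xv.
  apply: filterS (Uy (size v)).
  by apply: (cylinder_le _ xv (cylinder_letter_seq _ xy)); rewrite size_mkseq.
apply: filterS (Uy (size v).+1).
by apply: (cylinder_lt _ xv (cylinder_letter_seq _ xy)); rewrite size_mkseq.
Qed.

(** A generalized cylinder around [blur_seq w H] either is decided by [w] alone,
    and then contains the whole cylinder of [w], or is a blurred cylinder of [w]
    itself, necessarily for the same blurred set [H]. *)
Lemma cvg_blur_seq (U : set_system (full_blur V)) w H x : Filter U ->
  x = blur_seq w H :> (nat -> ext_alphabet V) ->
  (forall F, finite_set F -> U (blur_cylinder w H F)) -> U --> x.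
Proof.
move=> FU xw UF B /nbhs_generalized_cylinderP[Z gZ [Zx ZB]].
apply: filterS ZB _; have wx := cylinder_blur_seq xw.
have Uw : U (cylinder w) by apply: filterS (UF _ (finite_set0 _)) => t [].
case: gZ Zx => [[v _ <-]|[v [G [F [finF _ ->]]]]] xv.
  have [vw _] := cylinder_blur_seq_prefix xw xv.
  by apply: filterS Uw; exact: (cylinder_le vw xv wx).
have [] := cylinder_blur_seq_prefix xw xv.1.
rewrite leq_eqVlt => /orP[/eqP vw vE|vw _]; last first.
  by apply: filterS Uw; exact: (cylinder_lt vw xv wx).
have {}vE : v = w by rewrite vE vw take_size.
subst v; case: xv => _ [+ _].
by rewrite xw blur_seq_size => /ext_set_symbol <-; exact: UF.
Qed.

End FullBlur.

(** * The blur shift of a shift space *)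

Section BlurShift.
Context {A : choiceType} {V : set (set A)} (L : set (nat -> A)).
Implicit Types (w : seq A) (H : V) (x : full_blur V) (a : A).

Lemma blur_shift_letter_seq y x : L y ->
  x = letter_seq V y :> (nat -> ext_alphabet V) -> blur_shift V L x.
Proof. by move=> Ly xy; left; exists y. Qed.

Lemma blur_shift_language w x :
  blur_shift V L x -> cylinder w x -> language L w.
Proof.
move=> [[y Ly xy]|[v [H [Lv _ xv]]]] wx.
  have <- : mkseq y (size w) = w.
    apply: cylinder_inj (cylinder_letter_seq _ xy) wx _.
    by rewrite size_mkseq.
  by apply/languageP; right; exists y; rewrite ?size_mkseq.
have [_ ->] := cylinder_blur_seq_prefix xv wx.
exact: language_take.
Qed.

Lemma blur_shift_symbol w H x :
  blur_shift V L x -> cylinder w x -> x (size w) = inr H ->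
  infinite_set (followers L w `&` val H).
Proof.
move=> [[y Ly xy]|[v [G [Lv inf xv]]]] wx xH; first by rewrite xy in xH.
have [wv wE] := cylinder_blur_seq_prefix xv wx.
move: xH; rewrite xv => /blur_seq_symbol[vw ->].
by rewrite wE take_oversize.
Qed.

Lemma followers_active w H : shift_space L ->
  infinite_set (followers L w `&` val H) ->
  active_blurred_sets V L (val H).
Proof.
move=> HL inf; split; first exact: set_valP.
move=> finL; apply: inf; apply: sub_finite_set finL => a [+ Ha].
by move=> /(followers_letters HL).
Qed.

(** The first symbol takes finitely many values on [S], the points that do not
    start with a covered letter: a blurred cylinder of the empty word meets [S]
    only in its new symbol, its letters being covered. *)
Lemma compact_blur_shift_finite : shift_space L -> compact (blur_shift V L) ->
  finite_set (active_blurred_sets V L) /\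
  finite_set (letters L `\` \bigcup_(H in active_blurred_sets V L) H).
Proof.
move=> HL cX; set cov := \bigcup_(H in _) H.
pose first_symbol (x : full_blur V) := x 0.
pose S : set (full_blur V) :=
  [set x | blur_shift V L x /\ forall a, first_symbol x = inl a -> ~ cov a].
have finS : finite_set (first_symbol @` S).
  apply: finite_image_compact cX _ _ => [x []//|x Xx].
  case x0 : (first_symbol x) => [a|H].
    have xa : cylinder [:: a] x by exact: cylinder_rcons (cylinder_nil x) x0.
    exists (cylinder [:: a]).
      by apply: nbhs_generalized_cylinder xa; left; exists [:: a].
    apply: sub_finite_set (finite_set1 (inl a)) => _ [t [_ ta] <-].
    by case: ta.
  have actH : active_blurred_sets V L (val H).
    apply: (@followers_active [::]) => //.
    exact: (blur_shift_symbol Xx (cylinder_nil x)).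
  exists (blur_cylinder [::] H set0).
    apply: nbhs_generalized_cylinder.
      by right; exists [::], H, set0; split.
    have xH : ext_set H (first_symbol x) by rewrite x0; apply/ext_set_symbol.
    by apply/blur_cylinder0.
  apply: sub_finite_set (finite_set1 (inr H)).
  move=> _ [t [[_ tcov] /blur_cylinder0[_ tH]] <-].
  have {tH} : ext_set H (first_symbol t) := tH.
  case t0 : (first_symbol t) => [a|G].
    by move/ext_set_letter => Ha; case: (tcov a t0); exists (val H).
  by move/ext_set_symbol ->.
split.
  have fin_inr : finite_set (@inr A V @^-1` (first_symbol @` S)).
    by apply: finite_preimage finS => G H _ _ [].
  apply: sub_finite_set (finite_image val fin_inr) => H [VH infH].
  have [H' HE] := set_type_surj VH; subst H.
  have [x xH] := full_blur_blur_seq [::] H'.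
  exists H'; last by [].
  exists x; last by rewrite /first_symbol xH.
  split; last by move=> a; rewrite /first_symbol xH.
  right; exists [::], H'; split=> //; last by rewrite followers_nil.
  by apply/languageP; left.
have fin_inl : finite_set (@inl A V @^-1` (first_symbol @` S)).
  by apply: finite_preimage finS => a b _ _ [].
apply: sub_finite_set fin_inl => a [/lettersP[y Ly ya] ncov].
have [x xy] := full_blur_letter_seq (V := V) y.
exists x; last by rewrite /first_symbol xy /letter_seq ya.
split; first exact: blur_shift_letter_seq xy.
by move=> b; rewrite /first_symbol xy /letter_seq ya => -[<-].
Qed.

(** Following the extensions from the empty word builds the limit letter by
    letter.  Its prefixes are in the language because a member of [U] meets the
    blur shift. *)
Lemma ultra_cvg_extendable (U : set_system (full_blur V)) :
  shift_space L -> UltraFilter U -> U (blur_shift V L) ->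
  (forall w, U (cylinder w) -> exists a, U (cylinder (rcons w a))) ->
  exists2 x, blur_shift V L x & U --> x.
Proof.
move=> HL UU UX ext.
(* [a0] is the value for words whose cylinder is not in [U]. *)
have [a0 _] : exists a, U (cylinder (rcons [::] a)).
  apply: ext; exact: filterS (fun x _ => cylinder_nil x) filterT.
have /choice[g gP] : forall w, exists a,
    U (cylinder w) -> U (cylinder (rcons w a)).
  move=> w; have [/ext[a wa]|nw] := pselect (U (cylinder w)).
    by exists a.
  by exists a0.
pose prefix n := iter n (fun w => rcons w (g w)) [::].
pose y n := g (prefix n).
have yE n : mkseq y n = prefix n.
  by elim: n => // n IH; rewrite mkseqS IH.
have Uy n : U (cylinder (mkseq y n)).
  rewrite yE; elim: n => [|n IH]; last exact: gP.
  exact: filterS (fun x _ => cylinder_nil x) filterT.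
have Ly : L y.
  apply: shift_space_closed => // n.
  have [x [Xx yx]] := filter_ex (filterI UX (Uy n)).
  exact: blur_shift_language Xx yx.
have [x xy] := full_blur_letter_seq (V := V) y.
by exists x; [exact: blur_shift_letter_seq xy|exact: cvg_letter_seq xy Uy].
Qed.

(** The hypotheses cover the points that extend [w] by finitely many sets. *)
Lemma ultra_cvg_stuck (U : set_system (full_blur V)) w :
  shift_space L -> UltraFilter U -> U (blur_shift V L) ->
  finite_set (active_blurred_sets V L) ->
  finite_set (letters L `\` \bigcup_(H in active_blurred_sets V L) H) ->
  U (cylinder w) -> (forall a, ~ U (cylinder (rcons w a))) ->
  exists2 x, blur_shift V L x & U --> x.
Proof.
move=> HL UU UX finV finL Uw stuck; set cov := \bigcup_(H in _) H in finL.
have UnF F : finite_set F -> ~ U (\bigcup_(a in F) cylinder (rcons w a)).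
  by move=> finF /(ultra_bigcup _ finF)[a _ /stuck].
pose act : set V := [set H | active_blurred_sets V L (val H)].
have finact : finite_set act.
  by apply: finite_preimage finV => G H _ _; exact: val_inj.
(* The finite cover: [U] selects the next symbol up to one blurred set. *)
have [H actH UH] : exists2 H, act H & U (blur_cylinder w H set0).
  apply: ultra_bigcup => //.
  have [//|/UnF] : U (\bigcup_(H in act) blur_cylinder w H set0) \/
     U (\bigcup_(a in letters L `\` cov) cylinder (rcons w a)); last by [].
  apply: ultra_setU; apply: filterS (filterI UX Uw) => x [Xx wx].
  case xw : (x (size w)) => [a|H].
    have wax := cylinder_rcons wx xw.
    have La : letters L a.
      apply: (followers_letters HL (w := w)).
      exact: blur_shift_language Xx wax.
    have [[G actG Ga]|ncov] := pselect (cov a); last by right; exists a.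
    have [VG _] := actG; have [G' GE] := set_type_surj VG; subst G.
    left; exists G' => //.
    by apply/blur_cylinder0; split=> //; rewrite xw; apply/ext_set_letter.
  left; exists H.
    exact: followers_active HL (blur_shift_symbol Xx wx xw).
  by apply/blur_cylinder0; split=> //; rewrite xw; apply/ext_set_symbol.
(* Otherwise [blur_seq w H] is not in the blur shift, whose points in the blurred
   cylinder then lie in finitely many of the cylinders avoided by [U]. *)
have infH : infinite_set (followers L w `&` val H).
  move=> finH; apply: (UnF _ finH).
  apply: filterS (filterI UX UH) => x [Xx /blur_cylinder0[wx]].
  case xw : (x (size w)) => [a|G].
    have wax := cylinder_rcons wx xw.
    move/ext_set_letter => Ha; exists a => //; split=> //.
    exact: blur_shift_language Xx wax.
  move/ext_set_symbol => GH; subst G.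
  by have := blur_shift_symbol Xx wx xw.
have [z [Xz wz]] := filter_ex (filterI UX Uw).
have [x xw] := full_blur_blur_seq w H.
exists x.
  by right; exists w, H; split=> //; exact: blur_shift_language Xz wz.
apply: cvg_blur_seq xw _ => F finF.
have [//|UC] := in_ultra_setVsetC (\bigcup_(a in F) cylinder (rcons w a)) UU.
  by move/(UnF _ finF).
apply: filterS (filterI UH UC) => t [/blur_cylinder0[wt Ht] nF].
split=> //; split=> // -[a Fa ta]; apply: nF; exists a => //.
exact: cylinder_rcons wt (esym ta).
Qed.

End BlurShift.

Theorem theorem3p24 (A : pointedType) (V : set (set A)) (L : set (nat -> A))
    (HV : resolution V) (HL : shift_space L) :
  compact (blur_shift V L) <->
  finite_set (active_blurred_sets V L) /\
  finite_set (letters L `\` \bigcup_(H in active_blurred_sets V L) H).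
Proof.
split; first exact: compact_blur_shift_finite.
move=> [finV finL]; rewrite compact_ultra => U UU UX.
suff [x Xx Ux] : exists2 x, blur_shift V L x & U --> x by exists x.
have [ext|] :=
    pselect (forall w, U (cylinder w) -> exists a, U (cylinder (rcons w a))).
  exact: ultra_cvg_extendable ext.
move=> /existsNP[w /not_implyP[Uw /forallNP stuck]].
exact: ultra_cvg_stuck Uw stuck.
Qed.
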